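(* Let $X$ be a Banach space over $\mathbb{F}$ ($\mathbb{F}=\mathbb{R}$ or $\mathbb{C}$), let $\mathcal{L}$ be a subspace lattice on $X$ such that $\wedge\{L_-:L\in\mathcal{P}_{\mathcal{L}}\}=(0)$, and let $\delta:\mathrm{Alg}\mathcal{L}\to B(X)$ be a linear mapping. Then $\delta$ is Jordan derivable at zero point if and only if $\delta$ is a generalized derivation and $\delta(I)\in(\mathrm{Alg}\mathcal{L})'$. In particular, if $\delta(I)=0$, then $\delta$ is Jordan derivable at zero point if and only if $\delta$ is a derivation.
   Context: $B(X)$ is the algebra of bounded linear operators on $X$. A subspace of $X$ means a norm-closed linear manifold. A subspace lattice on $X$ is a collection $\mathcal{L}$ of subspaces of $X$ containing $(0)$ and $X$ such that for every family $\{M_r\}$ in $\mathcal{L}$ the intersection $\wedge M_r$ and the closed linear span $\vee M_r$ belong to $\mathcal{L}$ (the closed span of an empty family is $(0)$, and the intersection of an empty family is $X$). $\mathrm{Alg}\mathcal{L}$ is the algebra of operators in $B(X)$ that leave every member of $\mathcal{L}$ invariant, and $(\mathrm{Alg}\mathcal{L})'$ is its commutant in $B(X)$. For $E\in\mathcal{L}$, $E_-=\vee\{F\in\mathcal{L}:F\nsupseteq E\}$, and $\mathcal{P}_{\mathcal{L}}=\{L\in\mathcal{L}:L_-\nsupseteq L\}$. A linear mapping $\delta:\mathrm{Alg}\mathcal{L}\to B(X)$ is Jordan derivable at zero point if $\delta(AB+BA)=\delta(A)B+A\delta(B)+\delta(B)A+B\delta(A)$ for all $A,B\in\mathrm{Alg}\mathcal{L}$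 with $AB+BA=0$. It is a derivation if $\delta(AB)=\delta(A)B+A\delta(B)$ for all $A,B$, and a generalized derivation if $\delta(AB)=\delta(A)B+A\delta(B)-A\delta(I)B$ for all $A,B$. *)

(* Defs.v *)
From HB Require Import structures.
From mathcomp Require Import all_boot all_order all_algebra.
From mathcomp Require Import complex.
From mathcomp Require Import all_classical all_reals all_analysis.

Set Implicit Arguments.
Unset Strict Implicit.
Unset Printing Implicit Defensive.

Import Order.TTheory GRing.Theory Num.Theory.
Import numFieldNormedType.Exports.

Local Open Scope classical_set_scope.
Local Open Scope ring_scope.

Section BoundedOperators.
Variables (K : numFieldType) (X : completeNormedModType K).

Definition bounded_operator (f : X -> X) : Prop :=
  linear f /\ exists M : K, forall x, `|f x| <= M * `|x|.

Definition bop_pred : {pred X -> X} := fun f => `[< bounded_operator f >].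

Record bop := Bop { bop_fun :> X -> X; _ : bop_fun \in bop_pred }.

HB.instance Definition _ := [isSub for bop_fun].
HB.instance Definition _ := [Choice of bop by <:].

Lemma bopP (f : bop) : bounded_operator f.
Proof. by case: f => f /= /asboolP. Qed.

Lemma bop_ext (f g : bop) : (forall x, f x = g x) -> f = g.
Proof. by move=> fg; apply/val_inj/funext. Qed.

Lemma bounded_operator0 : bounded_operator (0 : X -> X).
Proof.
split; first by move=> a u v; apply/esym; rewrite scaler0; exact: addr0.
by exists 0 => x; rewrite mul0r normr0.
Qed.

Lemma bounded_operatorZD (a : K) (f g : X -> X) :
  bounded_operator f -> bounded_operator g -> bounded_operator (a *: f + g).
Proof.
move=> [lf [M hM]] [lg [N hN]].
have ZDE x : (a *: f + g) x = a *: f x + g x by [].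
split.
  move=> b u v; rewrite !ZDE lf lg !scalerDr !scalerA (mulrC a b).
  by rewrite addrACA.
exists (`|a| * M + N) => x; rewrite ZDE (le_trans (ler_normD _ _))//.
by rewrite normrZ mulrDl lerD// -mulrA ler_wpM2l.
Qed.

Lemma bounded_operator_id : bounded_operator id.
Proof. by split=> //; exists 1 => x; rewrite mul1r. Qed.

Lemma bounded_operator_comp (f g : X -> X) :
  bounded_operator f -> bounded_operator g -> bounded_operator (f \o g).
Proof.
move=> [lf [M hM]] [lg [N hN]]; split.
  by move=> b u v /=; rewrite lg lf.
exists (`|M| * `|N|) => x /=.
have le0 (c : K) (y z : X) : `|z| <= c * `|y| -> `|z| <= `|c| * `|y|.
  move=> h; have := le_trans (normr_ge0 z) h; move=> cy.
  by rewrite (le_trans h)// -[leLHS]ger0_norm// normrM normr_id.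
rewrite (le_trans (le0 _ _ _ (hM _)))// -mulrA ler_wpM2l//.
exact: le0.
Qed.

Fact bop_submod_closed : submod_closed bop_pred.
Proof.
split; first by apply/asboolP; exact: bounded_operator0.
move=> a f g /asboolP hf /asboolP hg.
by apply/asboolP; exact: bounded_operatorZD.
Qed.

HB.instance Definition _ :=
  GRing.isSubmodClosed.Build K (X -> X) bop_pred bop_submod_closed.
HB.instance Definition _ := [SubChoice_isSubLmodule of bop by <:].

(* The ring structure of B(X) is composition. It is only a pzRingType because
   X, hence B(X), may be trivial; this is also why the compatibility of the
   ring and module structures is given by the lemmas bop_scalerAl and
   bop_scalerAr rather than by an algType instance. *)
Definition bop_one : bop :=
  Bop (introT (asboolP _) bounded_operator_id).
Definition bop_mul (f g : bop) : bop :=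
  Bop (introT (asboolP _) (bounded_operator_comp (bopP f) (bopP g))).

Fact bop_mulA : associative bop_mul.
Proof. by move=> f g h; exact: bop_ext. Qed.
Fact bop_1mul : left_id bop_one bop_mul.
Proof. by move=> f; exact: bop_ext. Qed.
Fact bop_mul1 : right_id bop_one bop_mul.
Proof. by move=> f; exact: bop_ext. Qed.
Fact bop_mulDl : left_distributive bop_mul +%R.
Proof. by move=> f g h; exact: bop_ext. Qed.
Fact bop_mulDr : right_distributive bop_mul +%R.
Proof.
move=> f g h; apply: bop_ext => x /=.
have [lf _] := bopP f.
by have := lf 1 (g x) (h x); rewrite !scale1r.
Qed.

HB.instance Definition _ := GRing.Zmodule_isPzRing.Build bop
  bop_mulA bop_1mul bop_mul1 bop_mulDl bop_mulDr.

Lemma bop1E x : (1 : bop) x = x. Proof. by []. Qed.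
Lemma bopME (f g : bop) x : (f * g) x = f (g x). Proof. by []. Qed.
Lemma bop0E x : (0 : bop) x = 0. Proof. by []. Qed.
Lemma bopDE (f g : bop) x : (f + g) x = f x + g x. Proof. by []. Qed.
Lemma bopNE (f : bop) x : (- f) x = - f x. Proof. by []. Qed.
Lemma bopZE (a : K) (f : bop) x : (a *: f) x = a *: f x. Proof. by []. Qed.

Lemma bop_linear (f : bop) : linear f. Proof. by have [] := bopP f. Qed.

Lemma bop_scalerAl (a : K) (f g : bop) : a *: (f * g) = (a *: f) * g.
Proof. exact: bop_ext. Qed.

Lemma bop_scalerAr (a : K) (f g : bop) : a *: (f * g) = f * (a *: g).
Proof.
apply: bop_ext => x; rewrite bopZE !bopME bopZE.
have f0 : f 0 = 0.
  have := bop_linear f (-1) 0 0.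
  by rewrite scaler0 addr0 scaleN1r addNr.
by have := bop_linear f a (g x) 0; rewrite !addr0 f0 addr0.
Qed.

Definition commutant (S : set bop) : set bop :=
  [set T | forall A, S A -> T * A = A * T].

End BoundedOperators.

Section SubspaceLattices.
Variables (K : numFieldType) (X : completeNormedModType K).
Implicit Types (F : set (set X)) (E M : set X).

Definition linear_manifold M : Prop := submod_closed [in M].

Definition closed_subspace M : Prop := linear_manifold M /\ closed M.

(* [smallest linear_manifold S] is the linear span of S. *)
Definition closed_span (S : set X) : set X :=
  closure (smallest linear_manifold S).

(* [meet set0] is X and [join set0] is (0). *)
Definition meet F : set X := \bigcap_(M in F) M.

Definition join F : set X := closed_span (\bigcup_(M in F) M).

Definition subspace_lattice (L : set (set X)) : Prop :=
  [/\ forall M, L M -> closed_subspace M,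
      L [set 0],
      L [set: X],
      forall F, F `<=` L -> L (meet F)
    & forall F, F `<=` L -> L (join F)].

Record subspaceLattice := SubspaceLattice {
  members :> set (set X);
  subspaceLatticeP : subspace_lattice members }.

(* E_- and the family P_L of the members E of L with E not included in E_- *)
Definition lattice_minus (L : set (set X)) E : set X :=
  join [set F | L F /\ ~ E `<=` F].

Definition lattice_P (L : set (set X)) : set (set X) :=
  [set E | L E /\ ~ E `<=` lattice_minus L E].

Definition alg_set (L : set (set X)) : set (bop X) :=
  [set T | forall M, L M -> forall x, M x -> M (T x)].

Definition alg_pred (L : set (set X)) : {pred bop X} := fun T => `[< alg_set L T >].

Record alg (L : subspaceLattice) := Alg {
  alg_val :> bop X; _ : alg_val \in alg_pred L }.

Section AlgStructure.
Variable L : subspaceLattice.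

HB.instance Definition _ := [isSub for @alg_val L].
HB.instance Definition _ := [Choice of alg L by <:].

Lemma alg_valP (A : alg L) : alg_set L A.
Proof. by case: A => A /= /asboolP. Qed.

Fact alg_submod_closed : submod_closed (alg_pred L).
Proof.
have [sL _ _ _ _] := subspaceLatticeP L.
split.
  apply/asboolP => M /sL[[M0 _] _] x _.
  by rewrite bop0E; exact/set_mem.
move=> a S T /asboolP hS /asboolP hT; apply/asboolP => M LM x Mx.
have [[_ Mlin] _] := sL _ LM.
by apply/set_mem/Mlin; apply/mem_set; [exact: hS|exact: hT].
Qed.

Fact alg_subring_closed : subring_closed (alg_pred L).
Proof.
have [_ Slin] := alg_submod_closed; split.
- by apply/asboolP => M _ x.
- by move=> S T hS hT; rewrite -scaleN1r addrC Slin.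
- move=> S T /asboolP hS /asboolP hT; apply/asboolP => M LM x Mx.
  by apply: hS => //; exact: hT.
Qed.

HB.instance Definition _ :=
  GRing.isSubringClosed.Build (bop X) (alg_pred L) alg_subring_closed.
HB.instance Definition _ :=
  GRing.isSubmodClosed.Build K (bop X) (alg_pred L) alg_submod_closed.
HB.instance Definition _ :=
  GRing.SubChoice_isSubPzRing.Build (bop X) (alg_pred L) (alg L)
    alg_subring_closed.
HB.instance Definition _ := [SubZmodule_isSubLmodule of alg L by <:].

Definition jordan_derivable_at_zero (delta : alg L -> bop X) : Prop :=
  forall A B : alg L, A * B + B * A = 0 ->
    delta (A * B + B * A) =
      delta A * val B + val A * delta B + delta B * val A + val B * delta A.

Definition derivation (delta : alg L -> bop X) : Prop :=
  forall A B : alg L, delta (A * B) = delta A * val B + val A * delta B.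

Definition generalized_derivation (delta : alg L -> bop X) : Prop :=
  forall A B : alg L,
    delta (A * B) = delta A * val B + val A * delta B - val A * delta 1 * val B.

End AlgStructure.
End SubspaceLattices.

(* Main.v *)
(* Let D = delta(I). Testing the hypothesis on the pair (P, I - P) shows that D
   commutes with every idempotent P and that d = delta - D is an honest
   derivation at P. Each rank-one operator x (x) f with E in P_L, x in E and
   f vanishing on E_- is a combination of rank-one idempotents of Alg L. By
   Hahn-Banach and the hypothesis on the E_-, these operators F are faithful:
   if F T = 0 for all of them then T = 0; hence D commutes with Alg L.
   For a rank-one idempotent P, a Peirce decomposition of A gives
   d(PA) = d(P) A + P d(A): the only component not controlled by pairs of the
   form (2P - I, Z) is the opposite corner of d(Z), and it is killed by
   d(Z) Z + Z d(Z) = 0, since Z^2 = 0 and P has rank one. Expanding d(FAB) in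
   two ways then yields F (d(AB) - d(A) B - A d(B)) = 0. *)
Require Import Defs.
From HB Require Import structures.
From mathcomp Require Import all_boot all_order all_algebra.
From mathcomp Require Import complex.
From mathcomp Require Import all_classical all_reals all_analysis.
From mathcomp Require Import ring lra.
From Stdlib Require Ncring Ncring_tac.

Import Order.TTheory GRing.Theory Num.Theory.
Import numFieldNormedType.Exports.

Local Open Scope classical_set_scope.
Local Open Scope ring_scope.

(** * Hahn-Banach separation *)

(* [iota] is the inclusion of the reals in K, so that a single proof serves both
   scalar fields: a complex space is used as a real one through [iota]. *)
Section HahnBanach.
Context {R : realType} {K : numFieldType} (iota : {rmorphism R -> K}).
Context {V : lmodType K} (p : V -> R).
Hypothesis p_subadd : forall x y, p (x + y) <= p x + p y.
Hypothesis p_homog : forall a x, 0 < a -> p (iota a *: x) = a * p x.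

(** Partial real-linear functionals are kept as graphs in [V * R], ordered by inclusion for Zorn's
    lemma; single-valuedness is derived from domination inside [hahn_banach]. *)
Definition linear_graph (G : set (V * R)) : Prop :=
  forall a x r y s, G (x, r) -> G (y, s) -> G (iota a *: x + y, a * r + s).

Definition dominated (G : set (V * R)) : Prop := forall x r, G (x, r) -> r <= p x.

Lemma linear_graph_scale G a x r :
  linear_graph G -> G (x, r) -> G (iota a *: x, a * r).
Proof.
move=> lG Gx; have := lG (a - 1) x r x r Gx Gx.
by rewrite rmorphB rmorph1 scalerBl scale1r mulrBl mul1r !subrK.
Qed.

(** By homogeneity the constraints on the value [c] at [v] reduce to [a = 1] and [a = -1]: it must
    lie between all [r - p (x - v)] and all [p (x' + v) - r']. Subadditivity makes the supremum of
    the former fit. *)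
Lemma dominated_extension G v : linear_graph G -> dominated G -> G !=set0 ->
  exists c, let G' := [set u : V * R | exists x r a,
      [/\ G (x, r), u.1 = x + iota a *: v & u.2 = r + a * c]] in
    linear_graph G' /\ dominated G'.
Proof.
move=> lG dG [[x0 r0] G0].
pose S : set R := [set t | exists x r, G (x, r) /\ t = r - p (x - v)].
have S0 : S !=set0 by exists (r0 - p (x0 - v)), x0, r0.
have ubS x' r' : G (x', r') -> ubound S (p (x' + v) - r').
  move=> G' _ [x [r [Gx ->]]].
  have := dG _ _ (lG 1 _ _ _ _ Gx G').
  rewrite rmorph1 scale1r mul1r.
  have := p_subadd (x - v) (x' + v).
  by rewrite addrACA addNr addr0; lra.
have supS : has_sup S by split => //; exists (p (x0 + v) - r0); exact: ubS.
exists (sup S); split.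
  move=> a _ _ _ _ [x [r [b [/= Gx -> ->]]]] [y [s [c [/= Gy -> ->]]]].
  exists (iota a *: x + y), (a * r + s), (a * b + c); split => /=.
  - exact: lG.
  - by rewrite scalerDr scalerA -rmorphM addrACA -scalerDl -rmorphD.
  - by ring.
move=> _ _ [x [r [a [/= Gx -> ->]]]].
have [a0|a0|->] := ltgtP a 0; last first.
- by rewrite rmorph0 scale0r mul0r !addr0; exact: dG.
- have := ge_sup S0 (ubS _ _ (linear_graph_scale _ a^-1 _ _ lG Gx)).
  have -> : x + iota a *: v = iota a *: (iota a^-1 *: x + v).
    by rewrite scalerDr scalerA -rmorphM divff ?rmorph1 ?scale1r// gt_eqF.
  rewrite p_homog// -(ler_pM2l a0) mulrBr mulVKf ?gt_eqF//; lra.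
- have b0 : 0 < - a by rewrite oppr_gt0.
  have : S ((- a)^-1 * r - p (iota (- a)^-1 *: x - v)).
    by eexists _, _; split; [exact: (linear_graph_scale _ (- a)^-1 _ _ lG Gx)|].
  move=> /(ub_le_sup supS.2); rewrite -(ler_pM2l b0) mulrBr mulVKf ?gt_eqF//.
  rewrite -p_homog// scalerBr scalerA -rmorphM divff ?rmorph1 ?scale1r ?gt_eqF//.
  by rewrite rmorphN scaleNr opprK; lra.
Qed.

Theorem hahn_banach G0 :
  linear_graph G0 -> dominated G0 -> G0 !=set0 -> p 0 <= 0 ->
  exists f : V -> R,
    [/\ forall a x y, f (iota a *: x + y) = a * f x + f y,
        forall x, f x <= p x
      & forall x r, G0 (x, r) -> f x = r].
Proof.
move=> lG0 dG0 G00 p0.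
(* [Zorn_bigcup] also tests the empty chain, whose union is empty; hence containing [G0] is only
   required of nonempty [G]. *)
pose P (G : set (V * R)) :=
  [/\ linear_graph G, dominated G & G !=set0 -> G0 `<=` G].
have Pchain F : F `<=` P -> total_on F subset -> P (\bigcup_(G in F) G).
  move=> FP Ftot; split.
  - move=> a x r y s [G FG Gx] [H FH Hy].
    have [/(_ _ Gx) Hx|/(_ _ Hy) Gy] := Ftot _ _ FG FH.
      by exists H => //; have [lH _ _] := FP _ FH; exact: lH.
    by exists G => //; have [lG _ _] := FP _ FG; exact: lG.
  - by move=> x r [G FG]; have [_ + _] := FP _ FG; exact.
  - move=> [u [G FG Gu]] w G0w; exists G => //.
    by have [_ _ G0G] := FP _ FG; exact: (G0G (ex_intro _ u Gu)) G0w.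
have [G [[lG dG GG0] maxG]] := Zorn_bigcup Pchain.
have Gne : G !=set0.
  apply: contrapT => /nonemptyPn GE; apply: (maxG G0); last by split => // _ u.
  rewrite GE; split; first exact: sub0set.
  by move=> h; case: G00 => u /h.
have {GG0} GG0 := GG0 Gne.
have G_total v : exists r, G (v, r).
  have [c] := dominated_extension G v lG dG Gne.
  set G' := [set u | _] => -[lG' dG'].
  have GG' : G `<=` G'.
    move=> [x r] Gx; exists x, r, 0.
    by rewrite rmorph0 scale0r mul0r !addr0.
  have PG' : P G' by split => // _; exact: subset_trans GG'.
  have G'G : G' `<=` G.
    by apply: contrapT => nG'G; exact: (maxG G').
  have [[x r] Gx] := Gne; exists (0 + c).
  have Gz : G (0, 0).
    by have := linear_graph_scale _ 0 _ _ lG Gx; rewrite rmorph0 scale0r mul0r.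
  apply: G'G; exists 0, 0, 1.
  by rewrite rmorph1 scale1r mul1r !add0r.
(* Subtracting the pairs puts [(0, r - s)] in [G], so [r - s <= p 0 <= 0]. *)
have G_fun x r s : G (x, r) -> G (x, s) -> r <= s.
  move=> Gr Gs; have := dG _ _ (lG (-1) _ _ _ _ Gs Gr).
  rewrite rmorphN rmorph1 scaleN1r addNr mulN1r; lra.
have /choice[f Gf] := G_total.
have fE x r : G (x, r) -> f x = r.
  by move=> Gx; apply/eqP; rewrite eq_le !(G_fun x).
exists f; split.
- by move=> a x y; apply/fE/lG.
- by move=> x; exact: dG.
- by move=> x r /GG0; exact: fE.
Qed.

End HahnBanach.

Section Functionals.
Context {K : numFieldType} {X : normedModType K}.

Definition bounded_functional (f : X -> K) : Prop :=
  (forall a x y, f (a *: x + y) = a * f x + f y) /\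
  exists C, 0 <= C /\ forall x, `|f x| <= C * `|x|.

End Functionals.

(** * Separating a point from a closed subspace by a bounded functional *)

Section Separation.
Context {R : realType} {K : numFieldType} (iota : {rmorphism R -> K}).
Hypothesis iota_le : {mono iota : a b / a <= b}.
Hypothesis iota_ge0 : forall e : K, 0 <= e -> exists r, iota r = e.
Context {X : completeNormedModType K}.

(** If [r > 0] bounds the distance from [y] to [M] from below, the map sending [m + t y] to [t], for
    real [t], is dominated by the norm divided by [r]; a Hahn-Banach extension of it is the
    functional sought. *)
Lemma real_linear_separation (M : set X) y : closed_subspace M -> ~ M y ->
  exists (f : X -> R) (C : K),
    [/\ forall a u v, f (iota a *: u + v) = a * f u + f v,
        0 <= C /\ forall u, `|iota (f u)| <= C * `|u|,
        forall u, M u -> f u = 0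
      & f y = 1].
Proof.
move=> [[M0 Mlin] cM] My.
have {}M0 : M 0 by exact: set_mem.
have {}Mlin a u v : M u -> M v -> M (a *: u + v).
  by move=> Mu Mv; apply/set_mem/Mlin; exact: mem_set.
have iota_inj : injective iota := fmorph_inj iota.
have iota_gt a : 0 < a -> 0 < iota a.
  by move=> a0; rewrite lt_def fmorph_eq0 gt_eqF//= -(rmorph0 iota) iota_le ltW.
(* Norms are nonnegative in [K], hence images of reals under [iota]; [nu] is the real-valued
   norm. *)
have /choice[nu nuE] (x : X) : exists r, iota r = `|x| by exact: iota_ge0.
have nu_ge0 x : 0 <= nu x by rewrite -iota_le rmorph0 nuE.
have nuD u v : nu (u + v) <= nu u + nu v.
  by rewrite -iota_le rmorphD !nuE ler_normD.
have nuZ a u : 0 < a -> nu (iota a *: u) = a * nu u.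
  by move=> a0; apply: iota_inj; rewrite rmorphM !nuE normrZ gtr0_norm ?iota_gt.
have nu0 : nu 0 = 0 by apply: iota_inj; rewrite nuE normr0 rmorph0.
have nuN u : nu (- u) = nu u by apply: iota_inj; rewrite !nuE normrN.
have [r r0 Mr] : exists2 r, 0 < r & forall u, M u -> r <= nu (u + y).
  have /nbhs_ballP[e /= e0 he] : nbhs y (~` M).
    by apply: open_nbhs_nbhs; split => //; exact: closed_openC.
  have [r re] := iota_ge0 e (ltW e0).
  exists r => [|u Mu].
    rewrite lt_neqAle -iota_le re rmorph0 ltW// andbT eq_sym.
    by rewrite -(fmorph_eq0 iota) re gt_eqF.
  rewrite leNgt; apply/negP => uy; apply: (he (- u)).
    rewrite -ball_normE /= opprK addrC -nuE -re lt_neqAle iota_le ltW// andbT.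
    by apply: contraTN uy => /eqP/iota_inj ->; rewrite ltxx.
  by have := Mlin (-1) _ _ Mu M0; rewrite scaleN1r addr0.
pose p x := r^-1 * nu x.
pose G0 := [set u : X * R | exists m, M m /\ u.1 = m + iota u.2 *: y].
have [] := @hahn_banach R K iota X p _ _ G0.
- by move=> u v; rewrite /p -mulrDr ler_wpM2l// invr_ge0 ltW.
- by move=> a x a0; rewrite /p nuZ// mulrCA.
- move=> a _ s _ t [m [Mm /= ->]] [n [Mn /= ->]].
  exists (iota a *: m + n) => /=; split; first exact: Mlin.
  by rewrite scalerDr scalerA addrACA -scalerDl rmorphD rmorphM.
- move=> _ t [m [Mm /= ->]].
  have [t0|t0] := leP t 0.
    by rewrite (le_trans t0)// mulr_ge0// invr_ge0 ltW.
  rewrite /p ler_pdivlMl//.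
  have -> : m + iota t *: y = iota t *: (iota t^-1 *: m + y).
    by rewrite scalerDr scalerA -rmorphM divff ?rmorph1 ?scale1r// gt_eqF.
  rewrite nuZ// mulrC ler_pM2l//; apply: Mr.
  by have := Mlin (iota t^-1) _ _ Mm M0; rewrite addr0.
- by exists (0, 0); exists 0; rewrite /= rmorph0 scale0r addr0.
- by rewrite /p nu0 mulr0.
move=> f [flin fp fG0]; exists f, (iota r^-1).
have fN u : f (- u) = - f u.
  have f0 : f 0 = 0.
    by have := flin 1 0 0; rewrite rmorph1 scaler0 addr0 mul1r; lra.
  by have := flin (-1) u 0; rewrite rmorphN rmorph1 scaleN1r !addr0 f0; lra.
split => //.
- split; first by rewrite -(rmorph0 iota) iota_le invr_ge0 ltW.
  move=> u; rewrite -nuE -rmorphM.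
  have := fp u; have := fp (- u); rewrite fN /p nuN => h1 h2.
  have [fu|fu] := leP 0 (f u).
    by rewrite ger0_norm ?iota_le// -(rmorph0 iota) iota_le.
  rewrite ler0_norm; last by rewrite -(rmorph0 iota) iota_le ltW.
  by rewrite -rmorphN iota_le.
- by move=> u Mu; apply: fG0; exists u; rewrite /= rmorph0 scale0r addr0.
- by apply: fG0; exists 0; rewrite /= rmorph1 scale1r add0r.
Qed.

End Separation.

Lemma functional_separation (R : realType) (K : numFieldType)
    (hK : K = R :> numFieldType \/ K = R[i]%C :> numFieldType)
    (X : completeNormedModType K) (M : set X) y :
  closed_subspace M -> ~ M y ->
  exists f : X -> K, [/\ bounded_functional f, forall u, M u -> f u = 0 & f y != 0].
Proof.
case: hK => eK; subst K => sM My.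
  have [||f [C [flin [C0 fC] fM fy]]] :=
      @real_linear_separation R R idfun _ _ X M y sM My.
  - by [].
  - by move=> e _; exists e.
  exists f; split => //; last by rewrite fy oner_eq0.
  by split => //; exists C.
have [||f [C [flin [C0 fC] fM fy]]] :=
    @real_linear_separation R R[i]%C (real_complex R) _ _ X M y sM My.
- by move=> a b; rewrite lecR.
- move=> e e0; exists (complex.Re e); move: e0; rewrite lecE /= => /andP[/eqP ie _].
  by case: e ie => a b /= ->.
have fD u v : f (u + v) = f u + f v.
  by have := flin 1 u v; rewrite rmorph1 scale1r mul1r.
have f0 : f 0 = 0 by have := fD 0 0; rewrite addr0; lra.
have fZ a u : f (a%:C%C *: u) = a * f u.
  by have := flin a u 0; rewrite !addr0 f0 addr0.
have fN u : f (- u) = - f u by have := fD u (- u); rewrite subrr f0; lra.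
(* Complexification of the real functional: [g (i u) = i g u] makes [g] complex-linear, and its real
   part is [f], so [g y] is nonzero. *)
pose g u : R[i] := (f u)%:C%C - 'i%C * (f ('i%C *: u))%:C%C.
have ii : 'i%C * 'i%C = -1 :> R[i] by rewrite -expr2 sqr_i.
have gD u v : g (u + v) = g u + g v.
  by rewrite /g scalerDr !fD !rmorphD; ring.
have gZ a u : g (a%:C%C *: u) = a%:C%C * g u.
  by rewrite /g scalerA ['i%C * a%:C%C]mulrC -scalerA !fZ !rmorphM; ring.
have gi u : g ('i%C *: u) = 'i%C * g u.
  rewrite /g scalerA ii scaleN1r fN rmorphN /= mulrBr mulrA ii.
  ring.
have norm_i : `|'i%C : R[i]| = 1.
  by rewrite normc_def /= expr0n /= add0r expr1n sqrtr1.
exists g; split.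
- split.
    move=> a u v; rewrite gD [in LHS](complexE a) scalerDl gD -scalerA gi !gZ.
    by rewrite [a in RHS]complexE; ring.
  exists (C + C); split; first exact: addr_ge0.
  move=> u; rewrite (le_trans (ler_normB _ _))// mulrDl lerD ?fC//.
  by rewrite normrM norm_i mul1r (le_trans (fC _))// normrZ norm_i mul1r.
- move=> u Mu; rewrite /g !fM ?rmorph0 ?mulr0 ?subr0//.
  have [[M0 Mlin] _] := sM.
  apply/set_mem; rewrite -[_ *: _]addr0.
  by apply: Mlin => //; exact: mem_set.
- apply/eqP => /(congr1 (@complex.Re R)); rewrite /g fy /= => /eqP.
  by rewrite mul0r mul1r !(mulr0, subr0, addr0, oppr0) oner_eq0.
Qed.

(** * Peirce identities *)

(* Makes the tactic [non_commutative_ring] available on MathComp rings. *)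
#[local] Instance pzRing_Ncring_ops (B : pzRingType) :
    @Ncring.Ring_ops B 0 1 +%R *%R (fun x y => x - y) -%R eq :=
  @Ncring.Build_Ring_ops _ _ _ _ _ _ _ _.

#[local] Instance pzRing_Ncring (B : pzRingType) :
  Ncring.Ring (Ro := pzRing_Ncring_ops B).
Proof.
split; rewrite /=.
- exact: RelationClasses.eq_equivalence.
- by move=> x y -> z w ->.
- by move=> x y -> z w ->.
- by move=> x y -> z w ->.
- by move=> x y ->.
- exact: add0r.
- exact: addrC.
- exact: addrA.
- exact: mul1r.
- exact: mulr1.
- exact: mulrA.
- exact: mulrDl.
- by move=> *; exact: mulrDr.
- by [].
- exact: subrr.
Qed.

Ltac ncring := Ncring_tac.non_commutative_ring.

Section PeirceIdentities.
Context {B : pzRingType}.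
Hypothesis double_eq0 : forall t : B, t + t = 0 -> t = 0.
Context (p : B).
Hypothesis pp : p * p = p.

Let xpp x : x * p * p = x * p. Proof. by rewrite -mulrA pp. Qed.
Let expand := (mulrDl, mulrDr, mulrBl, mulrBr, mulrN, mulNr, mul1r, mulr1,
  mulr0, mul0r, mulrA).

(** Here [d] and [D] stand for the values at [P] and at [I], and the hypothesis is the Jordan
    identity for the pair [(P, I - P)]. Compressing by [p] on both sides gives [p d p = p D p];
    one-sided multiplication then gives [p D = p D p = D p]. *)
Lemma jordan_idempotent_identity (d D : B) :
  d * (1 - p) + p * (D - d) + (D - d) * p + (1 - p) * d = 0 ->
  D * p = p * D /\ d = d * p + p * d - D * p.
Proof.
move=> E.
have pdp : p * d * p = p * D * p.
  apply/esym/eqP; rewrite -subr_eq0; apply/eqP/double_eq0.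
  have := congr1 (fun t => p * t * p) E.
  rewrite !(expand, pp, xpp) => F; rewrite -[RHS]F; ncring.
have pD : p * D = p * D * p.
  have := congr1 (fun t => p * t) E.
  rewrite !(expand, pp, xpp) pdp => F.
  by apply/eqP; rewrite -subr_eq0 -F; apply/eqP; ncring.
have Dp : D * p = p * D * p.
  have := congr1 (fun t => t * p) E.
  rewrite !(expand, pp, xpp) pdp => F.
  by apply/eqP; rewrite -subr_eq0 -F; apply/eqP; ncring.
have DpD : D * p = p * D by rewrite pD.
split => //; apply/eqP; rewrite -subr_eq0; apply/eqP/double_eq0.
transitivity (d * (1 - p) + p * (D - d) + (D - d) * p + (1 - p) * d
              + (D * p - p * D)); first by ncring.
by rewrite E DpD subrr addr0.
Qed.

(** From here on [c] is the value at [P] of a map vanishing at [I], and [cE] is its derivation rule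
    for [P P = P]. *)
Context (c : B).
Hypothesis cE : c = c * p + p * c.

(** The hypothesis is the Jordan identity for [(2P - I, Z)], available when [Z] is in an
    off-diagonal corner; [z] is the value at [Z]. *)
Lemma jordan_peirce_offdiag (Z z : B) :
  (c + c) * Z + (p + p - 1) * z + z * (p + p - 1) + Z * (c + c) = 0 ->
  z = c * Z + Z * c + p * z + z * p.
Proof.
move=> E; apply/eqP; rewrite eq_sym -subr_eq0; apply/eqP/double_eq0.
by rewrite -[RHS]E; ncring.
Qed.

(** The last hypothesis says that the corner of [z] opposite to that of [Z] vanishes. Multiplying
    the identity by [p] on the right then shows [Z c + z p = 0]. *)
Lemma jordan_peirce12 (Z z : B) : p * Z = Z -> Z * p = 0 ->
  z = c * Z + Z * c + p * z + z * p -> z * p = p * z * p ->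
  z = c * Z + p * z.
Proof.
move=> pZ Zp E zp.
have Zc : Z * c = Z * c * p by rewrite {1}cE mulrDr !mulrA Zp mul0r addr0.
have F : Z * c * p + p * z * p = 0.
  have := congr1 (fun t => t * p) E.
  rewrite !mulrDl -!mulrA Zp pp !mulr0 add0r !mulrA => F.
  by apply: (addIr (z * p)); rewrite -F add0r.
by rewrite {1}E Zc zp -[RHS]addr0 -F; ncring.
Qed.

(** Since [p W = 0], the conclusion is the derivation rule for the product [P W]. Multiplying by [p]
    on the left yields [p c W + p w p = 0], where [p c W = c W] and [p w p = p w]. *)
Lemma jordan_peirce21 (W w : B) : p * W = 0 -> W * p = W ->
  w = c * W + W * c + p * w + w * p -> p * w = p * w * p ->
  c * W + p * w = 0.
Proof.
move=> pW Wp E pw.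
have cW : c * W = p * c * W by rewrite {1}cE mulrDl -mulrA pW mulr0 add0r.
have := congr1 (fun t => p * t) E.
rewrite !mulrDr !mulrA pW pp mul0r addr0 -addrA addrCA => F.
apply: (addrI (p * w)); rewrite addr0 {3}F cW -pw; ncring.
Qed.

(** The hypothesis is the Jordan identity for [(P, V)]. Compressing it by [p] kills [p v p];
    multiplying by [p] on the left then leaves the claim. *)
Lemma jordan_peirce22 (V v : B) : p * V = 0 -> V * p = 0 ->
  c * V + p * v + v * p + V * c = 0 ->
  c * V + p * v = 0.
Proof.
move=> pV Vp E.
have cV : c * V = p * c * V by rewrite {1}cE mulrDl -mulrA pV mulr0 add0r.
have pvp : p * v * p = 0.
  apply: double_eq0; have := congr1 (fun t => p * t * p) E.
  rewrite !(mulrDl, mulrDr, mulr0, mul0r, mulrA) -[_ * V * p]mulrA.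
  by rewrite Vp pV !mul0r pp mulr0 add0r addr0 -[p * v * p * p]mulrA pp.
have := congr1 (fun t => p * t) E.
by rewrite !(mulrDr, mulrA) pp pvp pV mul0r mulr0 !addr0 cV.
Qed.

End PeirceIdentities.

(** * Shifts by multiplication with an element commuting with both factors *)

Section CentralShift.
Context {B : pzRingType} (D a b : B).
Hypotheses (Da : D * a = a * D) (Db : D * b = b * D).

Lemma jordan_sub_central (x y : B) : D * (a * b + b * a) = 0 ->
  (x - D * a) * b + a * (y - D * b) + (y - D * b) * a + b * (x - D * a)
    = x * b + a * y + y * a + b * x.
Proof.
move=> D0.
transitivity (x * b + a * y + y * a + b * x
  - (D * (a * b + b * a) + D * (a * b + b * a))
  + (D * a - a * D) * b + (D * b - b * D) * a); first by ncring.
by rewrite D0 Da Db !subrr !mul0r !addr0 subr0.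
Qed.

Lemma jordan_add_central (x y : B) : D * (a * b + b * a) = 0 ->
  x * b + a * y - a * D * b + (y * a + b * x - b * D * a)
    = x * b + a * y + y * a + b * x.
Proof.
move=> D0; rewrite -Da -Db.
transitivity (x * b + a * y + y * a + b * x - D * (a * b + b * a)); first by ncring.
by rewrite D0 subr0.
Qed.

Lemma derivation_add_central (x y : B) :
  x * b + a * y + D * (a * b) =
  (x + D * a) * b + a * (y + D * b) - a * D * b.
Proof. ncring. Qed.

End CentralShift.

(** * Rank-one idempotents *)

Section BoundedOperatorFacts.
Context {K : numFieldType} {X : completeNormedModType K}.
Implicit Types (S T : bop X).

Lemma bop_0 T : T 0 = 0.
Proof. by have := bop_linear T (-1) 0 0; rewrite scaler0 addr0 scaleN1r addNr. Qed.

Lemma bop_scale T a x : T (a *: x) = a *: T x.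
Proof. by have := bop_linear T a x 0; rewrite !addr0 bop_0 addr0. Qed.

Lemma bop_double_eq0 T : T + T = 0 -> T = 0.
Proof.
by move=> /eqP; rewrite -mulr2n -scaler_nat scaler_eq0 pnatr_eq0 => /eqP.
Qed.

End BoundedOperatorFacts.

Section JordanDerivableAtZero.
Context {K : numFieldType} {X : completeNormedModType K} {L : subspaceLattice X}.
Implicit Types (A B P Z : alg L).

(** [phi] is a bare function, linearity being carried by the operator [P]; with [x = 0] the operator
    [P = 0] qualifies as well. *)
Definition rank_one_idempotent P : Prop :=
  exists x (phi : X -> K), phi x = 1 /\ forall u, P u = phi u *: x.

Lemma alg_ext A B : (forall u, A u = B u) -> A = B.
Proof. by move=> AB; apply/val_inj/bop_ext. Qed.

Lemma algME A B u : (A * B) u = A (B u). Proof. by []. Qed.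
Lemma val_alg1 : val (1 : alg L) = 1. Proof. by []. Qed.
Lemma val_algM A B : val (A * B) = val A * val B. Proof. by []. Qed.
Lemma val_algD A B : val (A + B) = val A + val B. Proof. by []. Qed.
Lemma val_algB A B : val (A - B) = val A - val B. Proof. by []. Qed.
Lemma val_algZ a A : val (a *: A) = a *: val A. Proof. by []. Qed.
Lemma algZE a A u : (a *: A) u = a *: A u. Proof. by []. Qed.

Lemma rank_one_idempotentP P : rank_one_idempotent P -> P * P = P.
Proof.
move=> [x [phi [phix PE]]]; apply: alg_ext => u.
by rewrite algME (PE u) bop_scale PE phix scale1r.
Qed.

(** The scalar is [phi (A x)]. *)
Lemma rank_one_compress P A : rank_one_idempotent P ->
  exists a : K, P * A * P = a *: P.
Proof.
move=> [x [phi [phix PE]]]; exists (phi (A x)); apply: alg_ext => u.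
rewrite !algME algZE (PE u) !bop_scale PE.
by rewrite scalerA mulrC -scalerA.
Qed.

(** All values of [Z] are multiples of [x]; one of them is nonzero, so [S Z = 0] forces
    [S x = 0]. *)
Lemma rank_one_cancel_left P (S Z : bop X) : rank_one_idempotent P ->
  val P * Z = Z -> Z != 0 -> S * Z = 0 -> S * val P = 0.
Proof.
move=> [x [phi [phix PE]]] PZ Z0 SZ.
have [u Zu] : exists u, Z u != 0.
  apply: contrapT => h; case/eqP: Z0; apply: bop_ext => u; apply/eqP.
  by apply: contrapT => Zu; apply: h; exists u; apply/negP.
have ZE : Z u = phi (Z u) *: x by rewrite -PE -bopME PZ.
have Sx : S x = 0.
  have /eqP : (S * Z) u = 0 by rewrite SZ.
  rewrite bopME ZE bop_scale scaler_eq0 => /orP[/eqP p0|/eqP//].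
  by move: Zu; rewrite ZE p0 scale0r eqxx.
by apply: bop_ext => v; rewrite bopME PE bop_scale Sx scaler0.
Qed.

(** Here [W u = phi u *: W x] with [W x] nonzero, so [W S = 0] forces [phi] to vanish on the range
    of [S]. *)
Lemma rank_one_cancel_right P (S W : bop X) : rank_one_idempotent P ->
  W * val P = W -> W != 0 -> W * S = 0 -> val P * S = 0.
Proof.
move=> [x [phi [phix PE]]] WP W0 WS.
have WE u : W u = phi u *: W x by rewrite -bop_scale -PE -bopME WP.
have Wx : W x != 0.
  apply: contra_neq W0 => Wx; apply: bop_ext => u.
  by rewrite WE Wx scaler0.
apply: bop_ext => v; rewrite bopME PE.
have /eqP : (W * S) v = 0 by rewrite WS.
by rewrite bopME WE scaler_eq0 (negPf Wx) orbF => /eqP ->; rewrite scale0r.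
Qed.

(** * Jordan derivable maps at idempotents, and the product rule for rank-one ones *)

Section Derivable.
Context (d : {linear alg L -> bop X}).
Hypothesis jd : jordan_derivable_at_zero d.

Lemma jordan_zero A B : A * B + B * A = 0 ->
  d A * val B + val A * d B + d B * val A + val B * d A = 0.
Proof. by move=> AB; rewrite -(jd _ _ AB) AB linear0. Qed.

Lemma jordan_idempotent P : P * P = P ->
  d 1 * val P = val P * d 1 /\
  d P = d P * val P + val P * d P - d 1 * val P.
Proof.
move=> PP; have pp : val P * val P = val P by rewrite -val_algM PP.
apply: (jordan_idempotent_identity bop_double_eq0 _ pp).
have /jordan_zero : P * (1 - P) + (1 - P) * P = 0.
  by rewrite mulrBr mulrBl mulr1 mul1r PP subrr addr0.
by rewrite val_algB val_alg1 (linearB d).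
Qed.

Hypothesis d1 : d 1 = 0.

Lemma jordan_derivation_idempotent P : P * P = P ->
  d P = d P * val P + val P * d P.
Proof. by move=> /jordan_idempotent[_]; rewrite d1 mul0r subr0. Qed.

Lemma jordan_derivation_reflection P Z : P * P = P ->
  (P + P - 1) * Z + Z * (P + P - 1) = 0 ->
  d Z = d P * val Z + val Z * d P + val P * d Z + d Z * val P.
Proof.
move=> PP /jordan_zero.
rewrite val_algB val_algD val_alg1 (linearB d) (linearD d) d1 subr0.
exact: jordan_peirce_offdiag bop_double_eq0 _ _ _ _.
Qed.

(** [P] is placed on the left because faithfulness will test operators by left multiplication. *)
Lemma rank_one_left_multiplier P : rank_one_idempotent P ->
  forall A, d (P * A) = d P * val A + val P * d A.
Proof.
move=> rP A; have PP := rank_one_idempotentP P rP.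
have cE := jordan_derivation_idempotent P PP.
have pp : val P * val P = val P by rewrite -val_algM PP.
(* The pair [(Z, Z)] is admissible when [Z Z = 0], and its identity is twice the claim. *)
have sq0 Z : Z * Z = 0 -> d Z * val Z + val Z * d Z = 0.
  move=> ZZ; apply: bop_double_eq0.
  by rewrite addrA; apply: jordan_zero; rewrite ZZ addr0.
have PQ : P * (1 - P) = 0 by rewrite mulrBr mulr1 PP subrr.
have QP : (1 - P) * P = 0 by rewrite mulrBl mul1r PP subrr.
have PQ1 : P + (1 - P) = 1 by rewrite addrC subrK.
pose rule T := d (P * T) = d P * val T + val P * d T.
have ruleD S T : rule S -> rule T -> rule (S + T).
  by rewrite /rule mulrDr val_algD !(linearD d) !mulrDr => -> ->; rewrite addrACA.
(* The rule is additive, so it is checked on the four Peirce corners of [A] separately. *)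
have -> : A = P * A * P + P * A * (1 - P)
              + ((1 - P) * A * P + (1 - P) * A * (1 - P)).
  by rewrite -!mulrDr PQ1 !mulr1 -mulrDl PQ1 mul1r.
apply: (ruleD); apply: (ruleD); rewrite /rule.
- have [a PAP] := rank_one_compress P A rP.
  have dZ : d (a *: P) = a *: d P by rewrite linearZ.
  have -> : P * (P * A * P) = P * A * P by rewrite !mulrA PP.
  rewrite PAP dZ val_algZ.
  by rewrite -!bop_scalerAr -scalerDr -cE.
- set Z := P * A * (1 - P).
  have PZ : P * Z = Z by rewrite /Z !mulrA PP.
  have ZP : Z * P = 0 by rewrite /Z -mulrA QP mulr0.
  rewrite PZ.
  have ZE : d Z = d P * val Z + val Z * d P + val P * d Z + d Z * val P.
    apply: jordan_derivation_reflection => //.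
    by rewrite mulrBl mulrDl mulrBr mulrDr PZ ZP mul1r mulr1 addrK add0r sub0r subrr.
  have vPZ : val P * val Z = val Z by rewrite -val_algM PZ.
  have vZP : val Z * val P = 0 by rewrite -val_algM ZP.
  apply: (jordan_peirce12 _ pp _ cE _ _ vPZ vZP ZE).
  have [Z0|Z0] := eqVneq (val Z) 0.
    have -> : Z = 0 by exact/val_inj.
    by rewrite linear0 mulr0 mul0r.
  have Z2 : Z * Z = 0 by rewrite -{2}PZ mulrA ZP mul0r.
  (* Multiplying by [I - P] on the left kills [Z d(Z)] and leaves [(I - P) d(Z) Z = 0]; cancelling
     [Z] gives [(I - P) d(Z) P = 0]. *)
  have := congr1 (fun T => val (1 - P) * T) (sq0 _ Z2).
  have QZ : val (1 - P) * val Z = 0 by rewrite -val_algM mulrBl mul1r PZ subrr.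
  rewrite mulrDr mulr0 (mulrA _ (val Z)) QZ mul0r addr0 mulrA.
  move=> /(rank_one_cancel_left P _ _ rP vPZ Z0).
  rewrite val_algB val_alg1 mulrBl mul1r mulrBl => /eqP.
  by rewrite subr_eq0 => /eqP.
- set W := (1 - P) * A * P.
  have PW : P * W = 0 by rewrite /W !mulrA PQ !mul0r.
  have WP : W * P = W by rewrite /W -mulrA PP.
  rewrite PW linear0; apply/esym.
  have WE : d W = d P * val W + val W * d P + val P * d W + d W * val P.
    apply: jordan_derivation_reflection => //.
    by rewrite mulrBl mulrDl mulrBr mulrDr PW WP mul1r mulr1 addrK add0r sub0r addNr.
  have vPW : val P * val W = 0 by rewrite -val_algM PW.
  have vWP : val W * val P = val W by rewrite -val_algM WP.
  apply: (jordan_peirce21 _ pp _ cE _ _ vPW vWP WE).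
  have [W0|W0] := eqVneq (val W) 0.
    have -> : W = 0 by exact/val_inj.
    by rewrite linear0 mulr0 mul0r.
  have W2 : W * W = 0 by rewrite -{1}WP -mulrA PW mulr0.
  (* Mirror image: [W d(W) (I - P) = 0], and cancelling [W] gives [P d(W) (I - P) = 0]. *)
  have := congr1 (fun T => T * val (1 - P)) (sq0 _ W2).
  have WQ : val W * val (1 - P) = 0 by rewrite -val_algM mulrBr mulr1 WP subrr.
  rewrite mulrDl mul0r -(mulrA _ (val W)) WQ mulr0 add0r -(mulrA (val W)).
  move=> /(rank_one_cancel_right P _ _ rP vWP W0).
  rewrite val_algB val_alg1 mulrBr mulr1 mulrBr mulrA => /eqP.
  by rewrite subr_eq0 => /eqP.
- set V := (1 - P) * A * (1 - P).
  have PV : P * V = 0 by rewrite /V !mulrA PQ !mul0r.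
  have VP : V * P = 0 by rewrite /V -!mulrA QP !mulr0.
  rewrite PV linear0; apply/esym.
  have vPV : val P * val V = 0 by rewrite -val_algM PV.
  have vVP : val V * val P = 0 by rewrite -val_algM VP.
  apply: (jordan_peirce22 bop_double_eq0 _ pp _ cE _ _ vPV vVP).
  by rewrite jordan_zero// PV VP addr0.
Qed.

End Derivable.
End JordanDerivableAtZero.

(** * Rank-one operators of Alg L *)

Lemma bounded_functionalD (K : numFieldType) (X : normedModType K) (f g : X -> K) :
  bounded_functional f -> bounded_functional g ->
  bounded_functional (fun u => f u + g u).
Proof.
move=> [fl [C [C0 fC]]] [gl [D [D0 gD]]]; split.
  by move=> a u v; rewrite fl gl; ring.
exists (C + D); split; first exact: addr_ge0.
by move=> u; rewrite (le_trans (ler_normD _ _))// mulrDl lerD.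
Qed.

Lemma bounded_functional_comp (K : numFieldType) (X : completeNormedModType K)
    (f : X -> K) (T : bop X) :
  bounded_functional f -> bounded_functional (fun u => f (T u)).
Proof.
move=> [fl [C [C0 fC]]]; have [Tl [M TM]] := bopP T; split.
  by move=> a u v; rewrite Tl fl.
exists (C * `|M|); split; first exact: mulr_ge0.
move=> u; rewrite (le_trans (fC _))// -mulrA ler_wpM2l//.
by rewrite -[`|u|]normr_id -normrM ger0_norm// (le_trans (normr_ge0 _) (TM u)).
Qed.

Section RankOneOperators.
Context {K : numFieldType} {X : completeNormedModType K} {L : subspaceLattice X}.
Implicit Types (A B F : alg L) (E M : set X) (f g : X -> K).

Definition annihilates f M : Prop := forall u, M u -> f u = 0.

Lemma lattice_minus_sup E M : members L M -> ~ E `<=` M -> M `<=` lattice_minus L E.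
Proof.
move=> LM EM; apply: subset_trans (@subset_closure _ _).
by move=> u Mu N [_]; apply; exists M.
Qed.

Lemma lattice_minus_member E : members L (lattice_minus L E).
Proof. by have [_ _ _ _] := subspaceLatticeP L; apply => M []. Qed.

(** A member [M] either contains [E], hence [x], or is contained in [E_-], where [f] vanishes. *)
Lemma rank_one_alg E x f : members L E -> E x -> bounded_functional f ->
  annihilates f (lattice_minus L E) -> exists F, forall u, F u = f u *: x.
Proof.
move=> LE Ex [fl [C [C0 fC]]] fE.
have bT : bounded_operator (fun u => f u *: x).
  split; first by move=> a u v; rewrite fl scalerDl scalerA.
  exists (C * `|x|) => u; rewrite normrZ mulrAC; exact: ler_wpM2r.
pose T : bop X := Bop (introT (asboolP _) bT).
suff aT : alg_set L T by exists (Alg (introT (asboolP _) aT)).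
move=> M LM u Mu /=; have [/(_ _ Ex) Mx|EM] := pselect (E `<=` M).
  have [sL _ _ _ _] := subspaceLatticeP L.
  have [[M0 Mlin] _] := sL _ LM.
  by apply/set_mem; rewrite -[_ *: _]addr0; apply: Mlin => //; exact: mem_set.
rewrite fE ?scale0r; last exact: (lattice_minus_sup E M).
have [sL _ _ _ _] := subspaceLatticeP L.
by have [[M0 _] _] := sL _ LM; exact: set_mem.
Qed.

Definition elementary F : Prop := exists E x f,
  [/\ lattice_P L E, E x, bounded_functional f,
      annihilates f (lattice_minus L E) & forall u, F u = f u *: x].

(** The functional becomes [f] composed with [A]; it still vanishes on [E_-], a member of the
    lattice and so invariant under [A]. *)
Lemma elementaryM F A : elementary F -> elementary (F * A).
Proof.
move=> [E [x [f [PE Ex bf fE FE]]]]; exists E, x, (fun u => f (A u)); split=> //.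
- exact: bounded_functional_comp.
- move=> u Eu; apply: fE.
  have aA : alg_set L A := alg_valP A.
  exact: aA (lattice_minus_member E) u Eu.
- by move=> u; rewrite algME FE.
Qed.

Context {R : realType}.
Hypothesis hK : K = R :> numFieldType \/ K = R[i]%C :> numFieldType.

Lemma lattice_P_functional E : lattice_P L E -> exists z g,
  [/\ E z, bounded_functional g, annihilates g (lattice_minus L E) & g z != 0].
Proof.
move=> [LE /existsNP[z /not_implyP[Ez Nz]]].
have [sL _ _ _ _] := subspaceLatticeP L.
have [g [bg gE gz]] :=
  functional_separation _ _ hK _ _ _ (sL _ (lattice_minus_member E)) Nz.
by exists z, g.
Qed.

(* When f(x) = 0, x (x) f is (x+z) (x) f - z (x) f if some z in E has f(z) <> 0,
   and x (x) (f+g) - x (x) g if f(z) = 0 and g(z) <> 0. *)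
Lemma elementary_span (Q : alg L -> Prop) :
  (forall A B, Q A -> Q B -> Q (A - B)) -> (forall a A, Q A -> Q (a *: A)) ->
  (forall P, rank_one_idempotent P -> Q P) ->
  forall F, elementary F -> Q F.
Proof.
move=> QB QZ QP F [E [x [f [PE Ex bf fE FE]]]].
have [LE _] := PE.
(* If [h y] is nonzero, dividing by it turns the operator into an idempotent. *)
have Q1 (y : X) (h : X -> K) (G : alg L) :
    bounded_functional h -> h y != 0 -> (forall u, G u = h u *: y) -> Q G.
  move=> bh hy GE; have -> : G = h y *: ((h y)^-1 *: G).
    by rewrite scalerA divff// scale1r.
  apply/QZ/QP; exists y, (fun u => (h y)^-1 * h u); split; first by rewrite mulVf.
  by move=> u; rewrite algZE GE scalerA.
have Q2 (y : X) (h : X -> K) (z : X) (G : alg L) :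
    E y -> E z -> bounded_functional h ->
    annihilates h (lattice_minus L E) -> h z != 0 ->
    (forall u, G u = h u *: y) -> Q G.
  move=> Ey Ez bh hE hz GE.
  have [hy|] := eqVneq (h y) 0; last by move=> hy; exact: Q1 GE.
  have Eyz : E (y + z).
    have [sL _ _ _ _] := subspaceLatticeP L.
    have [[_ Elin] _] := sL _ LE.
    by apply/set_mem; rewrite -[y]scale1r; apply: Elin; exact: mem_set.
  have hyz : h (y + z) != 0.
    by have := bh.1 1 y z; rewrite scale1r mul1r hy add0r => ->.
  have [G1 G1E] := rank_one_alg E (y + z) h LE Eyz bh hE.
  have [G2 G2E] := rank_one_alg E z h LE Ez bh hE.
  have -> : G = G1 - G2.
    apply: alg_ext => u; rewrite GE [RHS]/= -[RHS]/(G1 u - G2 u) G1E G2E.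
    by rewrite scalerDr addrK.
  by apply: QB; [exact: Q1 G1E|exact: Q1 G2E].
have [z [g [Ez bg gE gz]]] := lattice_P_functional E PE.
have [fz|fz] := eqVneq (f z) 0; last exact: (Q2 x f z).
have bfg := bounded_functionalD _ _ _ _ bf bg.
have fgE : annihilates (fun u => f u + g u) (lattice_minus L E).
  by move=> u Eu; rewrite fE// gE// addr0.
have fgz : f z + g z != 0 by rewrite fz add0r.
have [G1 G1E] := rank_one_alg E x _ LE Ex bfg fgE.
have [G2 G2E] := rank_one_alg E x _ LE Ex bg gE.
have -> : F = G1 - G2.
  apply: alg_ext => u; rewrite FE -[RHS]/(G1 u - G2 u) G1E G2E.
  by rewrite scalerDl addrK.
by apply: QB; [exact: (Q2 _ _ z) G1E|exact: (Q2 _ _ z) G2E].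
Qed.

Hypothesis hL : meet [set lattice_minus L E | E in lattice_P L] = [set 0].

(** If [T y] were outside some [E_-], a functional [f] separating it from [E_-] and a nonzero [z] in
    [E] would give [f (T y) *: z = 0], a contradiction. So [T y] lies in every [E_-]. *)
Lemma elementary_faithful (T : bop X) :
  (forall F, elementary F -> val F * T = 0) -> T = 0.
Proof.
move=> FT; apply: bop_ext => y.
suff : meet [set lattice_minus L E | E in lattice_P L] (T y) by rewrite hL.
move=> _ [E PE <-]; have [LE _] := PE.
have [z [g [Ez bg gE gz]]] := lattice_P_functional E PE.
apply: contrapT => NTy.
have [sL _ _ _ _] := subspaceLatticeP L.
have [f [bf fE fTy]] :=
  functional_separation _ _ hK _ _ _ (sL _ (lattice_minus_member E)) NTy.
have [F FE] := rank_one_alg E z f LE Ez bf fE.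
have : (val F * T) y = 0 by rewrite FT//; exists E, z, f.
rewrite bopME FE => /eqP; rewrite scaler_eq0 (negPf fTy)/= => /eqP z0.
have [[/set_mem M0 _] _] := sL _ (lattice_minus_member E).
by move: gz; rewrite gE ?eqxx// z0.
Qed.

(** * From rank-one idempotents to the whole algebra *)

Section Derivable.
Context (delta : {linear alg L -> bop X}).
Hypothesis jd : jordan_derivable_at_zero delta.

(** Write [D] for [delta 1]. It commutes with the elementary operators [F] and [F A], so
    [F A D = D F A = F D A], and faithfulness removes [F]. *)
Lemma jordan_unit_commutes A : delta 1 * val A = val A * delta 1.
Proof.
have comF F : elementary F -> delta 1 * val F = val F * delta 1.
  apply: (@elementary_span (fun F => delta 1 * val F = val F * delta 1)).
  - by move=> B C BE CE; rewrite val_algB mulrBr BE CE mulrBl.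
  - by move=> a B BE; rewrite val_algZ -bop_scalerAr BE bop_scalerAl.
  - by move=> P /rank_one_idempotentP /(jordan_idempotent _ jd)[].
apply/esym/eqP; rewrite -subr_eq0; apply/eqP/elementary_faithful => F eF.
rewrite mulrBr mulrA -val_algM -comF; last exact: elementaryM.
by rewrite val_algM !mulrA comF// subrr.
Qed.

(** This shift reduces the problem to a map vanishing at the identity. *)
Definition centered A : bop X := delta A - delta 1 * val A.

Lemma centered_linear : linear centered.
Proof.
move=> a A B; rewrite /centered linearP val_algD val_algZ mulrDr -bop_scalerAr.
by rewrite scalerBr opprD addrACA.
Qed.

HB.instance Definition _ :=
  GRing.isLinear.Build K (alg L) (bop X) *:%R centered centered_linear.

Lemma centeredB A B : centered (A - B) = centered A - centered B.
Proof. exact: linearB. Qed.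

Lemma centeredZ a A : centered (a *: A) = a *: centered A.
Proof. exact: linearZ. Qed.

Lemma centered_jordan : jordan_derivable_at_zero centered.
Proof.
move=> A B AB; rewrite AB linear0 /centered.
have D0 : delta 1 * (val A * val B + val B * val A) = 0.
  by rewrite -!val_algM -val_algD AB mulr0.
rewrite jordan_sub_central//; try exact: jordan_unit_commutes.
by rewrite -(jd _ _ AB) AB linear0.
Qed.

Lemma centered1 : centered 1 = 0.
Proof. by rewrite /centered val_alg1 mulr1 subrr. Qed.

Lemma centered_derivation : derivation centered.
Proof.
(* The rule is linear in [F], so [elementary_span] reduces it to rank-one idempotents. *)
have mult F A : elementary F ->
    centered (F * A) = centered F * val A + val F * centered A.
  move=> eF; move: F eF A.
  apply: elementary_span.
  - move=> B C BE CE A; rewrite mulrBl !centeredB BE CE !mulrBl.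
    by rewrite opprD addrACA.
  - move=> a B BE A.
    have -> : a *: B * A = a *: (B * A) by apply: alg_ext.
    by rewrite !centeredZ BE scalerDr !bop_scalerAl.
  - move=> P rP A; apply: (rank_one_left_multiplier _ centered_jordan centered1 _ rP).
move=> A B; apply/eqP; rewrite -subr_eq0; apply/eqP/elementary_faithful => F eF.
have := mult _ (A * B) eF.
rewrite mulrA mult; last exact: elementaryM.
rewrite (mult F A)// val_algM [in RHS]val_algM => H.
rewrite mulrBr; apply/eqP; rewrite subr_eq0; apply/eqP.
(* The expansions of the value at [F A B] through [F (A B)] and [(F A) B] share this term. *)
apply: (addrI (centered F * (val A * val B))).
rewrite -H (mulrDr (val F) (centered A * _)) (mulrDl (centered F * _)).
by rewrite !mulrA addrA.
Qed.

Lemma jordan_generalized_derivation : generalized_derivation delta.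
Proof.
move=> A B.
have dE C : delta C = centered C + delta 1 * val C by rewrite /centered subrK.
by rewrite dE centered_derivation (dE A) (dE B) derivation_add_central.
Qed.

End Derivable.
End RankOneOperators.

Theorem theorem2p5 (R : realType) (K : numFieldType)
    (hK : K = R :> numFieldType \/ K = R[i]%C :> numFieldType)
    (X : completeNormedModType K) (L : subspaceLattice X)
    (hL : meet [set lattice_minus L E | E in lattice_P L] = [set 0])
    (delta : {linear alg L -> bop X}) :
  (jordan_derivable_at_zero delta <->
     generalized_derivation delta /\ commutant (alg_set L) (delta 1)) /\
  (delta 1 = 0 -> (jordan_derivable_at_zero delta <-> derivation delta)).
Proof.
have iffG : jordan_derivable_at_zero delta <->
    generalized_derivation delta /\ commutant (alg_set L) (delta 1).
  split=> [jd|[gd cD] A B AB].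
    split; first exact: (jordan_generalized_derivation hK hL).
    (* The commutant ranges over bare operators, so [A] is repackaged as an element of [alg L]. *)
    move=> A hA.
    exact: (jordan_unit_commutes hK hL _ jd (Alg (introT (asboolP _) hA))).
  have comD (C : alg L) : delta 1 * val C = val C * delta 1.
    have aC : alg_set L C := alg_valP C.
    exact: cD.
  (* Adding the formulas for [A B] and [B A], the correction terms combine to [D (A B + B A) = 0]
     with [D = delta 1]. *)
  rewrite linearD /= !gd.
  have D0 : delta 1 * (val A * val B + val B * val A) = 0.
    by rewrite -!val_algM -val_algD AB mulr0.
  exact: jordan_add_central.
split=> // d1; rewrite iffG; split=> [[gd _] A B|dd].
  by rewrite gd d1 mulr0 mul0r subr0.
split; first by move=> A B; rewrite dd d1 mulr0 mul0r subr0.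
by move=> A _; rewrite d1 mul0r mulr0.
Qed.
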